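(* The length of the Mochizuki 3-cocycle $\zeta$ of the 7-dihedral quandle $R_7$ is equal to eight, i.e. $l(\zeta)=8$.
   Context: A quandle is a non-empty set $X$ with a binary operation $(a,b)\mapsto a^b$ such that $a^a=a$ for all $a$; for each $y\in X$ the map $x\mapsto x^y$ is bijective; and $(a^b)^c=(a^c)^{(b^c)}$ for all $a,b,c$. The associated group is $G(X)=\langle X\mid b^{-1}ab\,(a^b)^{-1}\ (a,b\in X)\rangle$. An $X$-set is a set $S$ with a right action $(s,g)\mapsto s^g$ of $G(X)$. For an $X$-set $S$ and $m\ge 1$, $C^Q_m(X)_S$ is the free abelian group on $U^Q_m(X)_S=\{(s;a_1,\dots,a_m)\in S\times X^m\mid a_i\ne a_{i+1}\ (1\le i\le m-1)\}$, and $C^Q_0(X)_S$ is the free abelian group on $S$. Define homomorphisms $f,g:C^Q_m(X)_S\to C^Q_{m-1}(X)_S$ by $f(s;a_1,\dots,a_m)=\sum_{i=1}^m(-1)^i(s;a_1,\dots,a_{i-1},a_{i+1},\dots,a_m)$ and $g(s;a_1,\dots,a_m)=\sum_{i=1}^m(-1)^{i+1}(s^{a_i};a_1^{a_i},\dots,a_{i-1}^{a_i},a_{i+1},\dots,a_m)$, where terms having two equal consecutive colors $b_j=b_{j+1}$ are removed (read as $0$). Then $\partial=f+g$ satisfies $\partial\circ\partial=0$; cycles and boundaries of $(X,S)$ are with respect to $\partial$. The length $l(\gamma)$ of a non-zero chain $\gamma=\sum_u n_u u$ (written in the basis $U^Q_m(X)_S$) is $\sum_u|n_u|$. When $S=\{o\}$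 is a single point with trivial action we write $C^Q_m(X)$ and $(a_1,\dots,a_m)$ for $(o;a_1,\dots,a_m)$; an $m$-cocycle of $X$ with coefficients in an abelian group $A$ is a homomorphism $\theta: C^Q_m(X)\to A$ with $\theta\circ\partial=0$. Let $\pi:C^Q_m(X)_S\to C^Q_m(X)$, $\pi(s;a_1,\dots,a_m)=(a_1,\dots,a_m)$. For an $m$-cocycle $\theta$ of $X$ put $l(\theta,S)=\min\{l(\gamma)\mid \gamma \text{ is an } m\text{-cycle of }(X,S)\text{ with }\theta(\pi(\gamma))\ne0\}$ (and $l(\theta,S)=0$ if this set is empty), and $l(\theta)=\max\{l(\theta,S)\mid S\text{ an }X\text{-set}\}$ (and $l(\theta)=\infty$ if the set is unbounded). $l(\theta)$ is called the length of $\theta$. The 7-dihedral quandle $R_7$ is the cyclic group $\mathbb{Z}/7\mathbb{Z}$ with $a^b=2b-a$. The Mochizuki 3-cocycle of $R_7$ is the homomorphism $\zeta:C^Q_3(R_7)\to\mathbb{Z}/7\mathbb{Z}$ given by $\zeta(a,b,c)=(a-b)\,\dfrac{b^7+(2c-b)^7-2c^7}{7}$ (compute with integer representatives of $a,b,c$, then reduce modulo $7$; this is a well-defined 3-cocycle). *)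

(* Defs.v *)
From HB Require Import structures.
From mathcomp Require Import all_boot all_order all_algebra ring.
From mathcomp Require Import boolp.
From mathcomp Require Import freeg.

Set Implicit Arguments.
Unset Strict Implicit.
Unset Printing Implicit Defensive.

Import GRing.Theory.
Local Open Scope quotient_scope.

(** * Groups given by generators and relators *)

(* The letter (x, false) stands for the generator x, and (x, true) for its
   inverse. *)
Definition word (X : Type) := seq (X * bool).

Definition letter_inv {X : Type} (l : X * bool) : X * bool := (l.1, ~~ l.2).

Definition word_inv {X : Type} (w : word X) : word X :=
  rev (map letter_inv w).

Section Presentation.
Variables (X : choiceType) (R : word X -> Prop).

Inductive pres_eq : word X -> word X -> Prop :=
| pres_refl w : pres_eq w w
| pres_sym u v : pres_eq u v -> pres_eq v u
| pres_trans u v w : pres_eq u v -> pres_eq v w -> pres_eq u w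
| pres_cat u u' v v' :
    pres_eq u u' -> pres_eq v v' -> pres_eq (u ++ v) (u' ++ v')
| pres_cancel l : pres_eq [:: l; letter_inv l] [::]
| pres_relator w : R w -> pres_eq w [::].

Definition pres_rel : rel (word X) := fun u v => `[< pres_eq u v >].

Lemma pres_rel_refl : reflexive pres_rel.
Proof. by move=> w; apply/asboolP; constructor. Qed.

Lemma pres_rel_sym : symmetric pres_rel.
Proof. by move=> u v; apply/asboolP/asboolP; apply: pres_sym. Qed.

Lemma pres_rel_trans : transitive pres_rel.
Proof.
move=> v u w /asboolP uv /asboolP vw; apply/asboolP.
exact: pres_trans uv vw.
Qed.

Canonical pres_equiv :=
  EquivRel pres_rel pres_rel_refl pres_rel_sym pres_rel_trans.

Definition presented_group : Type := {eq_quot pres_rel}.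

HB.instance Definition _ := Choice.on presented_group.
HB.instance Definition _ := Quotient.on presented_group.
HB.instance Definition _ : EqQuotient _ pres_rel presented_group :=
  EqQuotient.on presented_group.

Definition pres_class (w : word X) : presented_group :=
  \pi_presented_group w.

Definition pres_mul (x y : presented_group) : presented_group :=
  pres_class (repr x ++ repr y).

Definition pres_inv (x : presented_group) : presented_group :=
  pres_class (word_inv (repr x)).

Lemma pres_classP u v : pres_class u = pres_class v <-> pres_eq u v.
Proof. by split=> [/eqmodP/asboolP|uv] //; apply/eqmodP/asboolP. Qed.

Lemma pres_repr w : pres_eq (repr (pres_class w)) w.
Proof. by apply/pres_classP; rewrite /pres_class reprK. Qed.

Lemma pres_mulE u v :
  pres_mul (pres_class u) (pres_class v) = pres_class (u ++ v).
Proof. by apply/pres_classP/pres_cat; apply: pres_repr. Qed.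

Lemma pres_word_mulV w : pres_eq (w ++ word_inv w) [::].
Proof.
elim/last_ind: w => [|w l IHw]; first exact: pres_refl.
rewrite /word_inv map_rcons rev_rcons -cats1 -catA.
apply: pres_trans IHw; apply: (pres_cat (pres_refl _)).
exact: (pres_cat (pres_cancel l) (pres_refl _)).
Qed.

Lemma word_invK : involutive (@word_inv X).
Proof.
move=> w; rewrite /word_inv map_rev revK -map_comp map_id_in //.
by case=> x b _; rewrite /= /letter_inv negbK.
Qed.

Lemma pres_word_mulVg w : pres_eq (word_inv w ++ w) [::].
Proof. by have := pres_word_mulV (word_inv w); rewrite word_invK. Qed.

Lemma pres_eq_inv u v : pres_eq u v -> pres_eq (word_inv u) (word_inv v).
Proof.
move=> uv; apply: (@pres_trans _ (word_inv u ++ (v ++ word_inv v))).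
  rewrite -[X in pres_eq X _]cats0; apply: pres_cat; first exact: pres_refl.
  exact/pres_sym/pres_word_mulV.
rewrite catA -[X in pres_eq _ X]cat0s; apply: pres_cat; last exact: pres_refl.
apply: pres_trans (pres_word_mulVg u).
by apply: pres_cat; [exact: pres_refl | exact: pres_sym].
Qed.

Lemma pres_invE u : pres_inv (pres_class u) = pres_class (word_inv u).
Proof. by apply/pres_classP/pres_eq_inv/pres_repr. Qed.

Lemma pres_mulA : associative pres_mul.
Proof.
elim/quotW=> x; elim/quotW=> y; elim/quotW=> z.
by rewrite -!/(pres_class _) !pres_mulE catA.
Qed.

Lemma pres_mul1 : left_id (pres_class [::]) pres_mul.
Proof. by elim/quotW=> x; rewrite -/(pres_class _) pres_mulE. Qed.

Lemma pres_mulg1 : right_id (pres_class [::]) pres_mul.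
Proof. by elim/quotW=> x; rewrite -/(pres_class _) pres_mulE cats0. Qed.

Lemma pres_mulVg : left_inverse (pres_class [::]) pres_inv pres_mul.
Proof.
elim/quotW=> x; rewrite -/(pres_class _) pres_invE pres_mulE.
exact/pres_classP/pres_word_mulVg.
Qed.

Lemma pres_mulgV : right_inverse (pres_class [::]) pres_inv pres_mul.
Proof.
elim/quotW=> x; rewrite -/(pres_class _) pres_invE pres_mulE.
exact/pres_classP/pres_word_mulV.
Qed.

HB.instance Definition _ := isGroup.Build presented_group
  pres_mulA pres_mul1 pres_mulg1 pres_mulVg pres_mulgV.

Definition pres_gen (x : X) : presented_group := pres_class [:: (x, false)].

End Presentation.

(** * Quandles, associated groups and X-sets *)

(* qop a b is written a^b on paper. *)
HB.mixin Record isQuandle X of Choice X := {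
  qop : X -> X -> X;
  quandle_nonempty : inhabited X;
  qop_idem : forall a, qop a a = a;
  qop_bij : forall y, bijective (fun x => qop x y);
  qop_distr : forall a b c, qop (qop a b) c = qop (qop a c) (qop b c)
}.

#[short(type="quandleType")]
HB.structure Definition Quandle := {X of isQuandle X & Choice X}.

(* The relators b^-1 a b (a^b)^-1. *)
Definition assoc_relator (X : quandleType) (w : word X) : Prop :=
  exists a b : X,
    w = [:: (b, true); (a, false); (b, false); (qop a b, true)].

Definition assoc_group (X : quandleType) : groupType :=
  presented_group (@assoc_relator X).

Definition assoc_gen (X : quandleType) (a : X) : assoc_group X :=
  pres_gen (@assoc_relator X) a.

(* Classically every type carries a choiceType structure, so that the
   carrier of an X-set is an arbitrary set. *)
Record xset (X : quandleType) := XSet {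
  xset_sort :> choiceType;
  xact : xset_sort -> assoc_group X -> xset_sort;
  xact1 : forall s, xact s 1%g = s;
  xactM : forall s g h, xact s (g * h)%g = xact (xact s g) h
}.

Definition xset_point (X : quandleType) : xset X :=
  @XSet X unit (fun s _ => s) (fun=> erefl) (fun _ _ _ => erefl).

Local Open Scope ring_scope.

(** * Quandle chains *)

Section Chains.
Variables (X : quandleType) (S : xset X).

Definition nondegenerate m (u : S * m.-tuple X) : bool :=
  sorted (fun a b => a != b) u.2.

(* For m = 0 this is S times a point. *)
Definition chain_basis m := {u : S * m.-tuple X | nondegenerate u}.

Definition chain m := {freeg (chain_basis m)}.

Definition term m (u : S * m.-tuple X) : chain m :=
  if insub u is Some v then << (v : chain_basis m) >> else 0.

(* Indices start at 0 here, hence the shift by one in the signs of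
   boundary_f and boundary_g. *)
Definition face_f m (u : S * m.+1.-tuple X) (i : 'I_m.+1) : S * m.-tuple X :=
  (u.1, [tuple tnth u.2 (fintype.lift i j) | j < m]).

Definition face_g m (u : S * m.+1.-tuple X) (i : 'I_m.+1) : S * m.-tuple X :=
  let a := tnth u.2 in
  (xact u.1 (assoc_gen (a i)),
   [tuple (if (j < i)%N then qop (a (fintype.lift i j)) (a i) else a (fintype.lift i j))
    | j < m]).

Definition boundary_f m : chain m.+1 -> chain m :=
  fglift (fun u : chain_basis m.+1 =>
    \sum_(i < m.+1) (-1) ^+ i.+1 *: term (face_f (val u) i)).

Definition boundary_g m : chain m.+1 -> chain m :=
  fglift (fun u : chain_basis m.+1 =>
    \sum_(i < m.+1) (-1) ^+ i.+2 *: term (face_g (val u) i)).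

Definition boundary m (c : chain m.+1) : chain m :=
  boundary_f c + boundary_g c.

Lemma fgliftE (K : choiceType) (M : lmodType int) (h : K -> M) (c : {freeg K}) :
  fglift h c = \sum_(k <- dom c) coeff k c *: h k.
Proof.
pose H := @lift_is_additive int K M h.
pose A := GRing.isZmodMorphism.Build _ _ (fglift h) H.
pose L : {additive {freeg K} -> M} := HB.pack (fglift h) A.
rewrite -[c in LHS]freeg_sumE -[fglift h]/(L : _ -> _) raddf_sum.
by apply: eq_bigr => k _; rewrite /= liftU.
Qed.

Definition chain_length m (c : chain m) : nat :=
  (\sum_(u <- dom c) `|coeff u c|)%N.

End Chains.

Definition chain_proj (X : quandleType) (S : xset X) m :
    chain S m -> chain (xset_point X) m :=
  fglift (fun u : chain_basis S m => term ((tt, (val u).2) : xset_point X * _)).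

(** * Cocycles and their length *)

Record cocycle (X : quandleType) (m : nat) (A : zmodType) := Cocycle {
  cochain :> {additive chain (xset_point X) m -> A};
  cochain_boundary : forall c, cochain (boundary c) = 0
}.

Section CocycleLength.
Variables (X : quandleType) (m : nat) (A : zmodType).
Variable theta : cocycle X m.+1 A.

Definition detecting_length (S : xset X) (n : nat) : Prop :=
  exists c : chain S m.+1,
    [/\ boundary c = 0, theta (chain_proj c) <> 0 & chain_length c = n].

Definition length_wrt (S : xset X) : nat :=
  match pselect (exists n, `[< detecting_length S n >]) with
  | left ex => ex_minn ex
  | right _ => 0
  end.

Definition length_value (n : nat) : Prop := exists S, length_wrt S = n.

Lemma length_value_ex : exists n, `[< length_value n >].
Proof.
by exists (length_wrt (xset_point X)); apply/asboolP; exists (xset_point X).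
Qed.

Lemma length_value_ub N : (forall S, (length_wrt S <= N)%N) ->
  forall n, `[< length_value n >] -> (n <= N)%N.
Proof. by move=> ub n /asboolP[S <-]. Qed.

(* None stands for an infinite length. *)
Definition cocycle_length : option nat :=
  match pselect (exists N, forall S, (length_wrt S <= N)%N) with
  | left bounded =>
      Some (ex_maxn length_value_ex (length_value_ub (projT2 (cid bounded))))
  | right _ => None
  end.

End CocycleLength.

(** * The Mochizuki 3-cocycle of the 7-dihedral quandle *)

Definition R7 : Type := 'Z_7.

HB.instance Definition _ := GRing.ComNzRing.on R7.
HB.instance Definition _ := Finite.on R7.

Definition R7_op (a b : R7) : R7 := 2 * b - a.

Lemma R7_op_idem (a : R7) : R7_op a a = a.
Proof. rewrite /R7_op; ring. Qed.

Lemma R7_op_bij (y : R7) : bijective (fun x => R7_op x y).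
Proof. by exists (fun x => R7_op x y) => x; rewrite /R7_op; ring. Qed.

Lemma R7_op_distr (a b c : R7) :
  R7_op (R7_op a b) c = R7_op (R7_op a c) (R7_op b c).
Proof. rewrite /R7_op; ring. Qed.

HB.instance Definition _ := isQuandle.Build R7
  (inhabits 0) R7_op_idem R7_op_bij R7_op_distr.

(* The coercions 'Z_7 >-> nat >-> int pick the representatives 0, ..., 6; the
   value does not depend on this choice, by mochizuki_wd. *)
Definition mochizuki (a b c : R7) : 'Z_7 :=
  (a - b) *
  (((b%:Z ^+ 7 + (2 * c%:Z - b%:Z) ^+ 7 - 2 * c%:Z ^+ 7) %/ 7)%Z)%:~R.

Lemma mochizuki_divE (b c : int) :
  b ^+ 7 + (2 * c - b) ^+ 7 - 2 * c ^+ 7 =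
  2 * (3 * c ^+ 5 * (c - b) ^+ 2 + 5 * c ^+ 3 * (c - b) ^+ 4
       + c * (c - b) ^+ 6) * 7.
Proof. ring. Qed.

Lemma mochizuki_intE (b c : int) :
  (((b ^+ 7 + (2 * c - b) ^+ 7 - 2 * c ^+ 7) %/ 7)%Z)%:~R =
  2 * (3 * c%:~R ^+ 5 * (c%:~R - b%:~R) ^+ 2 +
       5 * c%:~R ^+ 3 * (c%:~R - b%:~R) ^+ 4 +
       c%:~R * (c%:~R - b%:~R) ^+ 6) :> 'Z_7.
Proof.
rewrite mochizuki_divE mulzK //.
by rewrite !(rmorphM, rmorphXn, rmorphB, rmorphD).
Qed.

Lemma R7_natr (a : R7) : (a%:Z)%:~R = a.
Proof. exact: natr_Zp. Qed.

Lemma mochizukiE (a b c : R7) : mochizuki a b c =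
  (a - b) * (2 * (3 * c ^+ 5 * (c - b) ^+ 2 + 5 * c ^+ 3 * (c - b) ^+ 4 +
                  c * (c - b) ^+ 6)).
Proof. by rewrite /mochizuki mochizuki_intE !R7_natr. Qed.

Lemma mochizuki_wd (a b c : int) :
  mochizuki a%:~R b%:~R c%:~R =
  (a - b)%:~R * (((b ^+ 7 + (2 * c - b) ^+ 7 - 2 * c ^+ 7) %/ 7)%Z)%:~R.
Proof. by rewrite mochizukiE mochizuki_intE rmorphB. Qed.

Lemma mochizuki_aab (a b : R7) : mochizuki a a b = 0.
Proof. by rewrite mochizukiE subrr mul0r. Qed.

Lemma mochizuki_abb (a b : R7) : mochizuki a b b = 0.
Proof. by rewrite mochizukiE subrr !expr0n /= !mulr0 !addr0 !mulr0. Qed.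

Lemma mochizuki_term_boundary (a b c d : R7) :
    - mochizuki b c d + mochizuki a c d - mochizuki a b d + mochizuki a b c
  + (mochizuki b c d - mochizuki (qop a b) c d
     + mochizuki (qop a c) (qop b c) d
     - mochizuki (qop a d) (qop b d) (qop c d)) = 0.
Proof.
pose m (x y z : R7) : R7 :=
  (x - y) * (2 * (3 * z ^+ 5 * (z - y) ^+ 2 + 5 * z ^+ 3 * (z - y) ^+ 4 +
                  z * (z - y) ^+ 6)).
pose q (x y : R7) : R7 := 2 * y - x.
pose t (a b c d : R7) : R7 :=
  - m b c d + m a c d - m a b d + m a b c
  + (m b c d - m (q a b) c d + m (q a c) (q b c) d
     - m (q a d) (q b d) (q c d)).
pose e : seq R7 := [:: 0; 1; 2; 3; 4; 5; 6].
have mem_e (x : R7) : x \in e by case: x => [] [|[|[|[|[|[|[|n]]]]]]].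
have /allP/(_ a (mem_e a))/allP/(_ b (mem_e b)) :
    all (fun a => all (fun b => all (fun c => all (fun d =>
      val (t a b c d) == 0%N) e) e) e) e.
  by vm_compute.
move=> /allP/(_ c (mem_e c))/allP/(_ d (mem_e d)) /eqP t0.
by rewrite !mochizukiE; apply: val_inj.
Qed.

Definition mochizuki_map : chain (xset_point R7) 3 -> 'Z_7 :=
  fglift (M := zmodule 'Z_7) (fun u : chain_basis (xset_point R7) 3 =>
    let a := tnth (val u).2 in
    mochizuki (a (inord 0)) (a (inord 1)) (a (inord 2))).

Lemma mochizuki_map_additive : additive mochizuki_map.
Proof. exact: (@lift_is_additive int _ (zmodule 'Z_7)). Qed.

HB.instance Definition _ := GRing.isZmodMorphism.Build
  (chain (xset_point R7) 3) 'Z_7 mochizuki_map mochizuki_map_additive.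

Lemma boundaryE (X : quandleType) (S : xset X) m (c : chain S m.+1) :
  boundary c = \sum_(u <- dom c) coeff u c *:
    (\sum_(i < m.+1) (-1) ^+ i.+1 *: term (face_f (val u) i) +
     \sum_(i < m.+1) (-1) ^+ i.+2 *: term (face_g (val u) i)).
Proof.
rewrite /boundary /boundary_f /boundary_g !fgliftE -big_split /=.
by apply: eq_bigr => u _; rewrite scalerDr.
Qed.

Lemma mochizuki_mapZ k c : mochizuki_map (k *: c) = mochizuki_map c *~ k.
Proof. by rewrite -[k in LHS]intz scaler_int raddfMz. Qed.

Lemma mochizuki_map_term (u : xset_point R7 * 3.-tuple R7) :
  mochizuki_map (term u) =
  let a := tnth u.2 in
  mochizuki (a (inord 0)) (a (inord 1)) (a (inord 2)).
Proof.
rewrite /term; case: insubP => [v _ <-|]; first by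
  rewrite /mochizuki_map liftU scale1r.
case: u => s [[|a [|b [|c []]]]] //= sz.
rewrite raddf0 /nondegenerate /= andbT negb_and !negbK !(tnth_nth a) /=.
rewrite !inordK //=.
by case/orP => /eqP ->; rewrite (mochizuki_aab, mochizuki_abb).
Qed.

Lemma mochizuki_boundary (c : chain (xset_point R7) 4) :
  mochizuki_map (boundary c) = 0.
Proof.
rewrite boundaryE raddf_sum big1 //= => u _. rewrite mochizuki_mapZ raddfD !raddf_sum /=.
rewrite !big_ord_recl !big_ord0 /=.
rewrite !mochizuki_mapZ !mochizuki_map_term /= !tnth_mktuple /=.
case: u => [[s [[|a [|b [|c0 [|d []]]]]] //= sz] nd].
rewrite !(tnth_nth a) /= !inordK //= /bump /=.
rewrite /unbump /= -!(signr_odd _ (_.+1)) /= !expr0 !expr1 !mulrN1z !mulr1z.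
rewrite [X in X *~ _](_ : _ = 0) ?mul0rz //.
by apply: etrans (mochizuki_term_boundary a b c0 d); rewrite !addr0 !addrA.
Qed.

Definition mochizuki_cocycle : cocycle R7 3 'Z_7 :=
  @Cocycle R7 3 'Z_7 mochizuki_map mochizuki_boundary.

(* Main.v *)
From HB Require Import structures.
From mathcomp Require Import all_boot all_order all_algebra ring zify.
From mathcomp Require Import freeg boolp.
Require Import Defs.

Set Implicit Arguments.
Unset Strict Implicit.
Unset Printing Implicit Defensive.

Import Order.TTheory GRing.Theory Num.Theory.
Local Open Scope ring_scope.

(** Both inequalities come from looking at a chain of length n as a list of n
    signed cells (s; a, b, c): it is a cycle when the signed faces of these
    cells cancel in pairs.

    Upper bound.  In the associated group the product of the generators of a
    and b depends only on b - a, because conjugation replaces the pair (a, b) by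
    (b, 2b - a), a translate of it (assoc_gen_mul).  Therefore, for every
    element s of every X-set, the eight cells of octet, which are placed at s,
    s^0 and s^1, form a cycle, and the cocycle takes the value 2 on it
    (octet_detects).  An empty X-set has no nonzero chain.

    Lower bound.  Take the integers as X-set, every generator acting by
    k |-> k + 1.  Then f preserves the layer k of a cell and g raises it by one.
    A cycle with at most seven cells is reconstructed from one of its cells:
    some cell of the cycle has to cancel a given uncancelled face, and a face
    has few cofaces.  Three facts make this search short enough to be carried
    out by computation (run_root).  When r cells are missing, they cancel at
    most 6r faces, so longer lists of uncancelled faces are hopeless
    (balanced_size).  Starting in the lowest layer and always treating the
    lowest uncancelled face leaves only cofaces with respect to f there.  An
    affine map of R_7 takes the initial cell to (0, 1, t), where t can be
    assumed minimal in the lowest layer.  The search meets a few cycles, and the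
    cocycle vanishes on all their affine images; removing such a cycle from the
    given one leaves a shorter cycle, so induction on the length concludes
    (short_cycle_null, short_layered_cycle). *)

(** * Signed lists *)

Section SignedLists.
Variable T : eqType.
Implicit Types (f g : bool * T) (l m : seq (bool * T)).

Definition opposite f : bool * T := (~~ f.1, f.2).

Definition signed_sum (V : zmodType) (phi : T -> V) l : V :=
  \sum_(f <- l) (if f.1 then - phi f.2 else phi f.2).

(** The formal sum of l is zero.  Quantifying over all functions, instead of
    counting occurrences, makes the property stable under every relabelling. *)
Definition balanced l : Prop := forall phi : T -> int, signed_sum phi l = 0.

Definition reduced l : Prop := forall f, f \in l -> opposite f \notin l.

(** Addition of a term to a formal sum in which opposite terms have already been
    cancelled. *)
Definition insert l f : seq (bool * T) :=
  if opposite f \in l then rem (opposite f) l else f :: l.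

Lemma oppositeK : involutive opposite.
Proof. by case=> e x; rewrite /opposite negbK. Qed.

Lemma signed_sum_cat (V : zmodType) (phi : T -> V) l m :
  signed_sum phi (l ++ m) = signed_sum phi l + signed_sum phi m.
Proof. exact: big_cat. Qed.

Lemma signed_sum_cons (V : zmodType) (phi : T -> V) f l :
  signed_sum phi (f :: l) =
  (if f.1 then - phi f.2 else phi f.2) + signed_sum phi l.
Proof. exact: big_cons. Qed.

Lemma signed_sum_perm (V : zmodType) (phi : T -> V) l m :
  perm_eq l m -> signed_sum phi l = signed_sum phi m.
Proof. exact: perm_big. Qed.

Lemma signed_sum_insert (V : zmodType) (phi : T -> V) l fs :
  signed_sum phi (foldl insert l fs) = signed_sum phi (l ++ fs).
Proof.
elim: fs l => [|f fs IHfs] l /=; first by rewrite cats0.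
rewrite IHfs !signed_sum_cat signed_sum_cons addrA; congr (_ + _).
rewrite /insert; case: ifP => [opp_l|_]; last by rewrite signed_sum_cons addrC.
rewrite (signed_sum_perm phi (perm_to_rem opp_l)) signed_sum_cons.
by case: f {opp_l} => [[] x] /=; rewrite addrAC ?subrr ?addNr add0r.
Qed.

Lemma balanced_perm l m : perm_eq l m -> balanced l -> balanced m.
Proof. by move=> lm bal_l phi; rewrite -(signed_sum_perm phi lm). Qed.

Lemma reduced_sub l m : {subset l <= m} -> reduced m -> reduced l.
Proof. by move=> lm red_m f /lm/red_m; apply/contra/lm. Qed.

Lemma reduced_insert l fs : reduced l -> reduced (foldl insert l fs).
Proof.
elim: fs l => //= f fs IHfs l red_l; apply: IHfs; rewrite /insert.
case: ifP => [_|/negbT f_l].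
  by apply: reduced_sub red_l; apply: mem_rem.
move=> g; rewrite !inE => /orP[/eqP->|g_l]; rewrite negb_or.
  by rewrite f_l andbT; case: (f) => [[] x]; rewrite xpair_eqE.
by rewrite red_l // andbT; apply: contra f_l => /eqP <-; rewrite oppositeK.
Qed.

Lemma size_insert l fs :
  (size l <= size (foldl insert l fs) + size fs)%N.
Proof.
elim: fs l => [|f fs IHfs] l /=; first by rewrite addn0.
have := IHfs (insert l f); rewrite {1}/insert.
by case: ifP => [/size_rem ->|_] /=; lia.
Qed.

Lemma signed_sum_indicator v l :
  signed_sum (fun x => (x == v)%:R) l =
  (count_mem (false, v) l)%:Z - (count_mem (true, v) l)%:Z.
Proof.
elim: l => [|[e x] l IHl]; first by rewrite /signed_sum big_nil subrr.
rewrite signed_sum_cons IHl /= !xpair_eqE.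
by case: e => /=; case: eqP => _ /=; lia.
Qed.

(** Nothing in l cancels f, so each copy of f is cancelled in m. *)
Lemma balanced_count l m f : reduced l -> balanced (l ++ m) ->
  (count_mem f l <= count_mem (opposite f) m)%N.
Proof.
move=> red_l /(_ (fun x => (x == f.2)%:R)).
rewrite signed_sum_indicator !count_cat.
have [/red_l /count_memPn|/count_memPn -> //] := boolP (f \in l).
case: f => [[] v]; rewrite /opposite /=; lia.
Qed.

Lemma balanced_mem l m f : reduced l -> balanced (l ++ m) -> f \in l ->
  opposite f \in m.
Proof.
move=> red_l bal; rewrite -!has_pred1 !has_count => f_l.
exact: leq_trans f_l (balanced_count _ red_l bal).
Qed.

(** This bounds the number of uncancelled faces that the remaining cells of a
    cycle can still cancel. *)
Lemma balanced_size l m : reduced l -> balanced (l ++ m) ->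
  (size l <= size m)%N.
Proof.
move=> red_l bal; rewrite -(size_map opposite m).
have /count_subseqP[l' /size_subseq le_l' ll'] :
    forall f, (count_mem f l <= count_mem f (map opposite m))%N.
  move=> f; apply: leq_trans (balanced_count f red_l bal) _.
  rewrite count_map; apply/eq_leq/eq_count => g /=.
  by apply/eqP/eqP => [->|<-]; rewrite oppositeK.
by rewrite (perm_size ll').
Qed.

End SignedLists.

Section Relabelling.
Variables (T U : eqType) (n : bool) (h : T -> U).
Implicit Types (f : bool * T) (l : seq (bool * T)).

Definition relabel f : bool * U := (n (+) f.1, h f.2).

Lemma relabel_opposite f : relabel (opposite f) = opposite (relabel f).
Proof. by rewrite /relabel /opposite /= addbN. Qed.

Lemma signed_sum_relabel (V : zmodType) (phi : U -> V) l :
  signed_sum phi (map relabel l) =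
  (if n then -%R else id) (signed_sum (phi \o h) l).
Proof.
rewrite /signed_sum big_map /=; case: n => //=; rewrite -sumrN.
by apply: eq_bigr => [[[] x]] _ //=; rewrite opprK.
Qed.

Lemma balanced_relabel l : balanced l -> balanced (map relabel l).
Proof.
move=> bal phi; rewrite signed_sum_relabel bal.
by case: n => //; rewrite oppr0.
Qed.

Lemma reduced_relabel l :
  {in [pred x | has (fun f => f.2 == x) l] &, injective h} ->
  reduced l -> reduced (map relabel l).
Proof.
move=> h_inj red_l _ /mapP[f f_l ->]; rewrite -relabel_opposite.
apply/mapP => -[g g_l [/addbI e /h_inj x]]; case/negP: (red_l f f_l).
have -> : opposite f = g.
  rewrite (surjective_pairing g) /opposite e x // inE; apply/hasP.
    by exists f.
  by exists g.
exact: g_l.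
Qed.

End Relabelling.

(** * Cells coloured by the dihedral quandle *)

(** The search below evaluates the quandle operation very often, so it uses
    these literals, and tables indexed by them, instead of the arithmetic of the
    ring of residues. *)
Definition R7_seq : seq R7 := [:: @Ordinal 7 0 isT; @Ordinal 7 1 isT;
  @Ordinal 7 2 isT; @Ordinal 7 3 isT; @Ordinal 7 4 isT; @Ordinal 7 5 isT;
  @Ordinal 7 6 isT].

Definition R7_nat (n : nat) : R7 := nth (@Ordinal 7 0 isT) R7_seq n.

Definition R7_eqb (a b : R7) : bool := eqn a b.

Lemma nth_R7_seq x0 (a : R7) : nth x0 R7_seq a = a.
Proof. by apply: val_inj; case: a => [[|[|[|[|[|[|[|n]]]]]]]]. Qed.

Lemma mem_R7_seq (a : R7) : a \in R7_seq.
Proof. by rewrite -(nth_R7_seq a a) mem_nth //; case: a. Qed.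

Lemma R7_natK (a : R7) : R7_nat a = a.
Proof. exact: nth_R7_seq. Qed.

Lemma R7_eqbE (a b : R7) : R7_eqb a b = (a == b).
Proof. by rewrite /R7_eqb eqnE. Qed.

Lemma R7_all (P : pred R7) : all P R7_seq -> forall a, P a.
Proof. by move=> /allP P_all a; apply/P_all/mem_R7_seq. Qed.

Definition tabulate T (f : R7 -> R7 -> T) : seq (seq T) :=
  [seq [seq f a b | b <- R7_seq] | a <- R7_seq].

Definition lookup T (x0 : T) (t : seq (seq T)) (a b : R7) : T :=
  nth x0 (nth [::] t a) b.

Lemma lookup_tabulate T (x0 : T) f a b : lookup x0 (tabulate f) a b = f a b.
Proof.
by rewrite /lookup (nth_map a) ?(nth_map b) ?nth_R7_seq ?ltn_ord.
Qed.

Definition op_table : seq (seq R7) :=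
  Eval vm_compute in tabulate (fun a b => R7_nat (qop a b : R7)).

Definition R7_mul (a b : R7) : R7 := lookup (R7_nat 0) op_table a b.

Lemma R7_mulE (a b : R7) : R7_mul a b = qop a b.
Proof.
rewrite /R7_mul.
have <- : tabulate (fun a b => R7_nat (qop a b : R7)) = op_table.
  by vm_compute.
by rewrite lookup_tabulate R7_natK.
Qed.

Lemma qopK (a b : R7) : qop (qop a b) b = a.
Proof. rewrite /qop /= /R7_op; ring. Qed.

(** Fermat's little theorem; a ^+ 5 serves as the inverse of a. *)
Lemma R7_expX6 (a : R7) : a != 0 -> a ^+ 5 * a = 1.
Proof.
move=> a_neq0; apply/eqP; move: a_neq0; apply/implyP; move: a.
by apply: R7_all; vm_compute.
Qed.

(** A tuple (k, a, b, c) stands for the basis element (k; a, b, c), and a pair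
    with true in front for its negative.  The labels k range over any type with
    a map act giving the label k^a, so that the same faces are used for X-sets,
    for layers and for a finite model of part of an X-set. *)
Definition ucell (I : Type) : Type := (I * R7 * R7 * R7)%type.
Definition uface (I : Type) : Type := (I * R7 * R7)%type.

Definition proper_face I (f : bool * uface I) : bool :=
  let: (_, (_, a, b)) := f in ~~ R7_eqb a b.

Definition proper_cell I (x : bool * ucell I) : bool :=
  let: (_, (_, a, b, c)) := x in ~~ R7_eqb a b && ~~ R7_eqb b c.

(** The three terms of f, followed by the three terms of g. *)
Definition cube_faces I (act : I -> R7 -> I) (x : bool * ucell I) :
    seq (bool * uface I) :=
  let: (e, (k, a, b, c)) := x in
  [:: (~~ e, (k, b, c)); (e, (k, a, c)); (~~ e, (k, a, b));
      (e, (act k a, b, c)); (~~ e, (act k b, R7_mul a b, c));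
      (e, (act k c, R7_mul a c, R7_mul b c))].

(** Faces with two equal colours are zero in the quandle chain group. *)
Definition faces I (act : I -> R7 -> I) (x : bool * ucell I) :
    seq (bool * uface I) :=
  [seq f <- cube_faces act x | proper_face f].

Definition all_faces I (act : I -> R7 -> I) (w : seq (bool * ucell I)) :=
  flatten (map (faces act) w).

Lemma all_faces_cons I (act : I -> R7 -> I) x w :
  all_faces act (x :: w) = faces act x ++ all_faces act w.
Proof. by []. Qed.

Definition map_cell I J (h : I -> J) (s : R7 -> R7) (x : ucell I) : ucell J :=
  let: (k, a, b, c) := x in (h k, s a, s b, s c).

Definition map_face I J (h : I -> J) (s : R7 -> R7) (f : uface I) : uface J :=
  let: (k, a, b) := f in (h k, s a, s b).

Definition equivariant I J (act : I -> R7 -> I) (act' : J -> R7 -> J)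
    (h : I -> J) (s : R7 -> R7) (x : bool * ucell I) : Prop :=
  let: (_, (k, a, b, c)) := x in
  forall d, d \in [:: a; b; c] -> h (act k d) = act' (h k) (s d).

Lemma map_cell_inj (I J : eqType) (D : {pred I}) (h : I -> J) s :
  {in D &, injective h} -> injective s ->
  {in [pred x : ucell I | x.1.1.1 \in D] &, injective (map_cell h s)}.
Proof.
move=> h_inj s_inj [[[k a] b] c] [[[k' a'] b'] c'] /= kD k'D [kE].
by rewrite (h_inj k k') // => /s_inj -> /s_inj -> /s_inj ->.
Qed.

Section Move.
Variables (I J : eqType) (act : I -> R7 -> I) (act' : J -> R7 -> J).
Variables (n : bool) (h : I -> J) (s : R7 -> R7).
Hypotheses (s_inj : injective s).
Hypothesis s_op : forall a b : R7, s (qop a b) = qop (s a) (s b).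

Lemma proper_cell_map x :
  proper_cell (relabel n (map_cell h s) x) = proper_cell x.
Proof. by case: x => e [[[k a] b] c]; rewrite /= !R7_eqbE !(inj_eq s_inj). Qed.

Lemma faces_map x : equivariant act act' h s x ->
  faces act' (relabel n (map_cell h s) x) =
  map (relabel n (map_face h s)) (faces act x).
Proof.
case: x => e [[[k a] b] c] h_act; rewrite /faces /=.
rewrite !R7_eqbE !R7_mulE -!s_op !(inj_eq s_inj) -!addbN.
rewrite -!h_act ?inE ?eqxx ?orbT // /relabel.
by do !case: (~~ (_ == _)).
Qed.

Lemma all_faces_map w : (forall x, x \in w -> equivariant act act' h s x) ->
  all_faces act' (map (relabel n (map_cell h s)) w) =
  map (relabel n (map_face h s)) (all_faces act w).
Proof.
elim: w => // x w IHw h_act.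
rewrite map_cons !all_faces_cons map_cat faces_map; last exact/h_act/mem_head.
by congr (_ ++ _); apply: IHw => y y_w; apply: h_act; rewrite inE y_w orbT.
Qed.

End Move.

Lemma size_all_faces I (act : I -> R7 -> I) w :
  (size (all_faces act w) <= 6 * size w)%N.
Proof.
elim: w => //= x w IHw; rewrite /all_faces /= size_cat mulnS leq_add //.
by case: x => e [[[k a] b] c]; rewrite size_filter count_size.
Qed.

Lemma all_faces_perm (I : eqType) (act : I -> R7 -> I) v w :
  perm_eq v w -> perm_eq (all_faces act v) (all_faces act w).
Proof. by move=> vw; apply/perm_flatten/perm_map. Qed.

Lemma all_faces_cat I (act : I -> R7 -> I) v w :
  all_faces act (v ++ w) = all_faces act v ++ all_faces act w.
Proof. by rewrite /all_faces map_cat flatten_cat. Qed.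

Definition weight I (u v : R7) (x : ucell I) : R7 :=
  let: (_, a, b, c) := x in
  mochizuki (u * a + v) (u * b + v) (u * c + v).

(** The search normalises the colours by an affine map, hence its outcome has to
    concern all the affine images of a cycle and not only the cycle itself. *)
Definition null (I : eqType) (w : seq (bool * ucell I)) : Prop :=
  forall u v : R7, signed_sum (weight u v) w = 0.

Lemma null_cat (I : eqType) (w1 w2 : seq (bool * ucell I)) :
  null w1 -> null w2 -> null (w1 ++ w2).
Proof. by move=> n1 n2 u v; rewrite signed_sum_cat n1 n2 addr0. Qed.

Lemma null_perm (I : eqType) (w1 w2 : seq (bool * ucell I)) :
  perm_eq w1 w2 -> null w1 -> null w2.
Proof. by move=> w12 n1 u v; rewrite -(signed_sum_perm _ w12) n1. Qed.

(** For u and v, the value of w at u * x + v is the value of its image at an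
    affine map again, since p is invertible. *)
Lemma null_affine (I J : eqType) n (h : I -> J) (p q : R7) w : p != 0 ->
  null (map (relabel n (map_cell h (fun x => p * x + q))) w) -> null w.
Proof.
move=> p_neq0 null_w u v.
have := null_w (u * p ^+ 5) (v - u * p ^+ 5 * q).
rewrite signed_sum_relabel.
have -> : signed_sum (weight (u * p ^+ 5) (v - u * p ^+ 5 * q) \o
    map_cell h (fun x => p * x + q)) w = signed_sum (weight u v) w.
  apply: eq_bigr => -[e [[[k a] b] c]] _ /=.
  have E (x : R7) : u * p ^+ 5 * (p * x + q) + (v - u * p ^+ 5 * q) = u * x + v.
    by rewrite -[u in RHS]mulr1 -(R7_expX6 p_neq0); ring.
  by rewrite !E.
by case: n {null_w} => // /eqP; rewrite oppr_eq0 => /eqP.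
Qed.

(** * Exhaustive search for short cycles *)

Definition face : Type := (bool * uface nat)%type.
Definition cell : Type := (bool * ucell nat)%type.

Definition level_up (k : nat) (a : R7) : nat := k.+1.

Definition cancel_face (f g : face) : bool :=
  let: (e, (k, a, b)) := f in let: (e', (k', a', b')) := g in
  [&& R7_eqb a a', R7_eqb b b', eqn k k' & e (+) e'].

Definition cancel_cell (x y : cell) : bool :=
  let: (e, (k, a, b, c)) := x in let: (e', (k', a', b', c')) := y in
  [&& R7_eqb a a', R7_eqb b b', R7_eqb c c', eqn k k' & e (+) e'].

Fixpoint remove_opposite (f : face) (l : seq face) : option (seq face) :=
  if l is g :: l' then
    if cancel_face f g then Some l'
    else if remove_opposite f l' is Some l'' then Some (g :: l'') else None
  else None.

(** Inserts the faces fs into the list l of uncancelled faces, giving up when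
    more than n of them meet no opposite. *)
Fixpoint absorb (n : nat) (fs l : seq face) : option (seq face) :=
  if fs is f :: fs' then
    if remove_opposite f l is Some l' then absorb n fs' l'
    else if n is n'.+1 then absorb n' fs' (f :: l) else None
  else Some l.

Fixpoint lowest (f : face) (l : seq face) : face :=
  if l is g :: l' then
    lowest (let: (_, (k, _, _)) := f in let: (_, (k', _, _)) := g in
            if (k <= k')%N then f else g) l'
  else f.

(** All the cells that cancel a given face.  For each colour x there are three
    of them in its own layer, where the face arises from the map f, and three in
    the layer below, where it arises from g, whose terms are inverted by means of
    (a^x)^x = a. *)
Definition cofaces (f : face) : seq cell :=
  let: (e, (k, a, b)) := f in
  flatten [seq [seq z <- [:: (e, (k, x, a, b)); (~~ e, (k, a, x, b));
                             (e, (k, a, b, x))] ++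
    if k is k'.+1 then
      [:: (~~ e, (k', x, a, b)); (e, (k', R7_mul a x, x, b));
          (~~ e, (k', R7_mul a x, R7_mul b x, x))]
    else [::] | proper_cell z] | x <- R7_seq].

(** The image of c under the affine map that takes a to 0 and b to 1; it
    classifies the triples with a != b up to affine maps. *)
Definition slope (a b c : R7) : R7 := (c - a) * (b - a) ^+ 5.

Definition slope_table : seq (seq (seq nat)) := Eval vm_compute in
  tabulate (fun a b => [seq nat_of_ord (slope a b c) | c <- R7_seq]).

Definition slope_code (a b c : R7) : nat :=
  nth 0%N (lookup [::] slope_table a b) c.

(** The search starts from a cell of the lowest layer with the least slope t
    there, so cells of that layer with a smaller slope can be discarded. *)
Definition allowed (t : nat) (x : cell) : bool :=
  let: (_, (k, a, b, c)) := x in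
  if k is 0%N then (t <= slope_code a b c)%N else true.

(** The polynomial expression of the cocycle modulo 7 avoids the seventh powers
    of integers and the division of its definition. *)
Definition null_test (w : seq cell) : bool :=
  all (fun u : R7 => all (fun v : R7 =>
    foldr (fun x s => let: (e, (_, a, b, c)) := x in
      let a := u * a + v in let b := u * b + v in let c := u * c + v in
      let z : R7 := (a - b) * (2 * (3 * c ^+ 5 * (c - b) ^+ 2 +
        5 * c ^+ 3 * (c - b) ^+ 4 + c * (c - b) ^+ 6)) in
      (if e then - z else z) + s) 0 w == 0) R7_seq) R7_seq.

(** With the cells w already chosen and the faces l not yet cancelled, tries all
    the ways of cancelling l by at most r further cells, and checks that every
    cycle found is null.  Cells opposite to a chosen one are left out, as they
    do not occur in a chain written without cancellation. *)
Fixpoint run (t r : nat) (w : seq cell) (l : seq face) : bool :=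
  if l is f :: l' then
    if r is r'.+1 then
      (* If m of the at most six faces of a new cell do not cancel, at least
         size l + 2 * m - 6 faces remain, and 6 * r' of them are allowed. *)
      let n := ((6 * r - size l)./2)%N in
      all (fun x =>
        if ~~ allowed t x || has (cancel_cell x) w then true
        else if absorb n (faces level_up x) l is Some l1
             then run t r' (x :: w) l1
        else true) (cofaces (lowest f l'))
    else true
  else null_test w.

Definition root_cell (t : nat) : cell :=
  (false, (0%N, R7_nat 0, R7_nat 1, R7_nat t)).

Definition reduced_test (l : seq face) : bool :=
  all (fun f => ~~ has (cancel_face f) l) l.

(** The slope 1 is left out, for it would make the last two colours equal. *)
Lemma run_root t : t \in [:: 0; 2; 3; 4; 5; 6]%N ->
  reduced_test (faces level_up (root_cell t)) &&
  run t 6 [:: root_cell t] (faces level_up (root_cell t)).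
Proof.
move: t; apply/allP.
by vm_compute.
Qed.

Lemma cancel_faceE f g : cancel_face f g = (g == opposite f).
Proof.
case: f g => [e [[k a] b]] [e' [[k' a'] b']].
rewrite /opposite /= !xpair_eqE !R7_eqbE eqnE (eq_sym a) (eq_sym b) (eq_sym k).
by case: e; case: e'; case: (a' == a); case: (b' == b); case: (k' == k).
Qed.

Lemma cancel_cellE x y : cancel_cell x y = (y == opposite x).
Proof.
case: x y => [e [[[k a] b] c]] [e' [[[k' a'] b'] c']].
rewrite /opposite /= !xpair_eqE !R7_eqbE eqnE.
rewrite (eq_sym a) (eq_sym b) (eq_sym c) (eq_sym k).
by case: e; case: e'; case: (a' == a); case: (b' == b); case: (c' == c);
  case: (k' == k).
Qed.

Lemma reduced_testP l : reduced_test l -> reduced l.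
Proof.
move=> /allP red_l f /red_l /hasPn opp_l; apply/negP => /opp_l.
by rewrite cancel_faceE eqxx.
Qed.

Lemma remove_oppositeE f l : remove_opposite f l =
  if opposite f \in l then Some (rem (opposite f) l) else None.
Proof.
elim: l => //= g l ->; rewrite cancel_faceE inE (eq_sym g).
by case: (opposite f =P g) => [->|_]; rewrite ?eqxx //=; case: ifP.
Qed.

Lemma size_gt0_mem (T : eqType) (x : T) (s : seq T) : x \in s -> (0 < size s)%N.
Proof. by case: s. Qed.

(** A face that cancels shortens the list by one, any other lengthens it by one;
    giving up means that more than n faces did not cancel. *)
Lemma absorbE n fs l :
  if absorb n fs l is Some l' then l' = foldl (@insert _) l fs
  else (size l + n.+1.*2 <= size (foldl (@insert _) l fs) + size fs)%N.
Proof.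
elim: fs n l => [|f fs IHfs] n l //=.
rewrite remove_oppositeE [insert l f]/insert.
case: ifP => [f_l|_].
  have := IHfs n (rem (opposite f) l); case: absorb => // le.
  move: le; rewrite size_rem //; case: (size l) (size_gt0_mem f_l) => // p _ /=.
  by move: (size (foldl _ _ _)) (size fs) => p1 p2; lia.
case: n => [|n]; first by
  have /= := size_insert (f :: l) fs;
  move: (size l) (size (foldl _ _ _)) (size fs); lia.
by have /= := IHfs n (f :: l); case: absorb => //=;
  move: (size l) (size (foldl _ _ _)) (size fs); lia.
Qed.

Lemma lowest_mem f l : lowest f l \in f :: l.
Proof.
elim: l f => [|g l IHl] f /=; first by rewrite mem_seq1.
set h := (h in lowest h l); suff: h \in [:: f; g].
  have := IHl h; rewrite !inE => /orP[/eqP->|->]; rewrite ?orbT //.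
  by rewrite orbA => ->.
rewrite {}/h; case: f g => [e [[k a] b]] [e' [[k' a'] b']].
by case: ifP => _; rewrite !inE eqxx ?orbT.
Qed.

Lemma faces_cofaces f x : proper_cell x -> opposite f \in faces level_up x ->
  x \in cofaces f.
Proof.
case: f x => [e [[k a] b]] [e' [[[k' a'] b'] c']] gen_x.
have in_cofaces y : (e', (k', a', b', c')) \in
    [:: (e, (k, y, a, b)); (~~ e, (k, a, y, b)); (e, (k, a, b, y))] ++
    (if k is k1.+1 then
      [:: (~~ e, (k1, y, a, b)); (e, (k1, R7_mul a y, y, b));
          (~~ e, (k1, R7_mul a y, R7_mul b y, y))]
    else [::]) -> (e', (k', a', b', c')) \in cofaces (e, (k, a, b)).
  move=> x_y; apply/flatten_mapP; exists y; first exact: mem_R7_seq.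
  by rewrite mem_filter gen_x.
rewrite /faces mem_filter => /andP[_]; rewrite /opposite /= !inE.
move=> /or4P[|||/or3P[]] /eqP[eE kE aE bE].
- by apply: (in_cofaces a'); rewrite kE aE bE -[e]negbK eE negbK inE eqxx.
- by apply: (in_cofaces b'); rewrite kE aE bE -eE !inE eqxx ?orbT.
- apply: (in_cofaces c'); rewrite kE aE bE -[e]negbK eE negbK.
  by rewrite !inE eqxx ?orbT.
- by apply: (in_cofaces a'); rewrite kE aE bE -eE !inE eqxx ?orbT.
- apply: (in_cofaces b'); rewrite kE aE bE -[e]negbK eE negbK.
  by rewrite !R7_mulE qopK !inE eqxx ?orbT.
- apply: (in_cofaces c'); rewrite kE aE bE -eE.
  by rewrite !R7_mulE !qopK !inE eqxx ?orbT.
Qed.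

Lemma null_testP w : null_test w -> null w.
Proof.
move=> null_w u v; apply/eqP.
have /allP/(_ u (mem_R7_seq u))/allP/(_ v (mem_R7_seq v)) := null_w.
congr (_ == _); elim: w {null_w} => [|[e [[[k a] b] c]] w IHw].
  by rewrite /signed_sum big_nil.
by rewrite signed_sum_cons -IHw /= mochizukiE.
Qed.

(** A list v that cancels l is only reconstructed up to the point where all the
    faces are cancelled, that is, up to a part v1 of v. *)
Lemma runP t r w l v :
    run t r w l -> reduced l -> reduced (w ++ v) ->
    balanced (l ++ all_faces level_up v) -> (size v <= r)%N ->
    all (@proper_cell nat) v -> all (allowed t) v ->
  exists v1 v2, [/\ perm_eq v (v1 ++ v2), null (w ++ v1) &
    balanced (l ++ all_faces level_up v1)].
Proof.
elim: r w l v => [|r IHr] w [|f l] v.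
- move=> null_w _ _ _ _ _ _; exists [::], v; rewrite !cats0.
  by split=> //; [exact: null_testP | move=> phi; rewrite /signed_sum big_nil].
- move=> _ red_l _ bal; rewrite leqn0 => /nilP v0 _ _; subst v.
  by have := balanced_mem red_l bal (mem_head _ _).
- move=> null_w _ _ _ _ _ _; exists [::], v; rewrite !cats0.
  by split=> //; [exact: null_testP | move=> phi; rewrite /signed_sum big_nil].
move=> /allP run_l red_l red_wv bal size_v gen_v all_v.
have g_l := lowest_mem f l; set g := lowest f l in run_l g_l.
have /flatten_mapP[x x_v x_g] := balanced_mem red_l bal g_l.
have /run_l := faces_cofaces (allP gen_v x x_v) x_g.
rewrite (allP all_v x x_v) /=; case: hasP => [[y y_w]|_].
  rewrite cancel_cellE => /eqP yE.
  by have := red_wv x; rewrite !mem_cat x_v orbT -yE y_w => /(_ isT).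
have v_x := perm_to_rem x_v.
set fl := f :: l; set n := (6 * r.+1 - size fl)./2.
pose l1 := foldl (@insert _) fl (faces level_up x).
have red_l1 : reduced l1 by exact: reduced_insert.
have bal1 : balanced (l1 ++ all_faces level_up (rem x v)).
  move=> phi; rewrite signed_sum_cat signed_sum_insert -signed_sum_cat -catA.
  rewrite -(bal phi); apply: signed_sum_perm; rewrite perm_cat2l perm_sym.
  by rewrite -all_faces_cons; exact: all_faces_perm.
have size_rem : (size (rem x v) <= r)%N.
  by rewrite size_rem //; case: (size v) size_v.
have := absorbE n (faces level_up x) fl; case: absorb => [_ -> run1|le _].
  have rem_v : {subset rem x v <= v} by exact: mem_rem.
  have [|||v1 [v2 [vE null1 bal_1]]] :=
    IHr _ _ (rem x v) run1 red_l1 _ bal1 size_rem.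
  - apply: reduced_sub red_wv => y.
    by rewrite inE !mem_cat => /or3P[/eqP->|->|/rem_v->]; rewrite ?x_v ?orbT.
  - by apply/allP => y /rem_v; apply/allP.
  - by apply/allP => y /rem_v; apply/allP.
  exists (x :: v1), v2; split.
  - by rewrite (perm_trans v_x) //= perm_cons.
  - by apply: null_perm null1; rewrite perm_sym -[x :: v1]cat1s perm_catCA.
  change (balanced (fl ++ all_faces level_up (x :: v1))) => phi.
  rewrite all_faces_cons -(bal_1 phi) !signed_sum_cat.
  by rewrite signed_sum_insert signed_sum_cat addrA.
have le1 := balanced_size red_l1 bal1.
have le2 := size_all_faces level_up (rem x v).
have le3 : (size (faces level_up x) <= 6)%N.
  by have := size_all_faces level_up [:: x]; rewrite /all_faces /= cats0.
have aux a b c d s : (a + ((6 * r.+1 - a)./2).+1.*2 <= b + c -> c <= 6 ->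
  d <= 6 * s -> s <= r -> b <= d -> False)%N by lia.
by case: (aux _ _ _ _ _ le le3 le2 size_rem le1).
Qed.

Lemma exists_minimal (T : eqType) (key : T -> nat) (w : seq T) : w != [::] ->
  exists2 x, x \in w & forall y, y \in w -> (key x <= key y)%N.
Proof.
elim: w => // y [|z w] IHw _.
  by exists y => [|y']; rewrite mem_seq1 // => /eqP ->.
have [//|x x_w x_min] := IHw; have [le|/ltnW le] := leqP (key y) (key x).
  exists y => [|y']; first exact: mem_head.
  by rewrite inE => /predU1P[-> //|/x_min]; apply: leq_trans.
exists x => [|y']; first by rewrite inE x_w orbT.
by rewrite inE => /predU1P[-> //|]; exact: x_min.
Qed.

Lemma slope_codeE (a b c : R7) : slope_code a b c = slope a b c.
Proof.
rewrite /slope_code.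
have <- : tabulate (fun a b => [seq nat_of_ord (slope a b c) | c <- R7_seq])
  = slope_table by vm_compute.
by rewrite lookup_tabulate (nth_map c) ?nth_R7_seq ?ltn_ord.
Qed.

Lemma slope_affine (p q a b c : R7) : p != 0 ->
  slope (p * a + q) (p * b + q) (p * c + q) = slope a b c.
Proof.
move=> p_neq0; rewrite -[RHS]mul1r -(R7_expX6 p_neq0) /slope; ring.
Qed.

Lemma slope_neq1 (a b c : R7) : a != b -> b != c -> slope a b c != 1.
Proof.
move=> ab bc; apply: contra bc => /eqP slope1; apply/eqP.
have ba : b - a != 0 by rewrite subr_eq0 eq_sym.
have e : (b - a) ^+ 5 * (c - b) = 0.
  rewrite [LHS](_ : _ = slope a b c - (b - a) ^+ 5 * (b - a)).
    by rewrite slope1 R7_expX6 // subrr.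
  by rewrite /slope; ring.
have : (c - b) * ((b - a) ^+ 5 * (b - a)) = 0.
  by rewrite mulrA (mulrC (c - b)) e mul0r.
by rewrite R7_expX6 // mulr1 => /subr0_eq.
Qed.

Lemma affine_inj (p q : R7) : p != 0 -> injective (fun x : R7 => p * x + q).
Proof.
move=> p_neq0 x y /addIr /(congr1 ( *%R (p ^+ 5))).
by rewrite !mulrA R7_expX6 // !mul1r.
Qed.

Lemma affine_op (p q a b : R7) :
  p * (qop a b : R7) + q = qop (p * a + q : R7) (p * b + q : R7).
Proof. rewrite /qop /= /R7_op; ring. Qed.

Lemma lex_leq k k' t t' :
  (7 * k + t <= 7 * k' + t' -> t' < 7 -> k <= k')%N.
Proof. lia. Qed.

(** The cell with the least layer, and the least slope in that layer, is moved
    to a root cell by an affine map, a shift of the layers and a change of sign.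
    The search splits off a null cycle, and what is left is shorter. *)
Lemma short_cycle_null (w : seq cell) :
  all (@proper_cell nat) w -> reduced w -> balanced (all_faces level_up w) ->
  (size w <= 7)%N -> null w.
Proof.
have [n] := ubnP (size w); elim: n w => // n IHn w; rewrite ltnS => size_n.
have [-> _ _ _ _ u v|w_neq0] := eqVneq w [::].
  by rewrite /signed_sum big_nil.
move=> gen_w red_w bal_w size_w.
(* Slopes are at most 6, so this orders by layer first. *)
pose key (x : cell) := let: (_, (k, a, b, c)) := x in (7 * k + slope a b c)%N.
have [[e [[[k a] b] c]] x_w x_min] := exists_minimal key w_neq0.
have /andP[ab bc] : (a != b) && (b != c).
  by have := allP gen_w _ x_w; rewrite /= !R7_eqbE.
have ba : b - a != 0 by rewrite subr_eq0 eq_sym.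
pose p := (b - a) ^+ 5; pose q := - (p * a).
have p_neq0 : p != 0.
  by apply/eqP => p0; have := R7_expX6 ba; rewrite -/p p0 mul0r => /eqP.
pose s (x : R7) : R7 := p * x + q.
have s_inj : injective s := affine_inj p_neq0.
pose T := relabel e (map_cell (subn^~ k) s).
pose t := nat_of_ord (slope a b c).
have rootE : T (e, (k, a, b, c)) = root_cell t.
  rewrite /T /root_cell /relabel addbb /= subnn R7_natK /s /q.
  congr (_, (_, _, _, _)).
  - by rewrite subrr; exact: val_inj.
  - by rewrite -mulrBr R7_expX6 //; exact: val_inj.
  - by rewrite /slope -/p; ring.
have k_min e' k' a' b' c' : (e', (k', a', b', c')) \in w -> (k <= k')%N.
  by move=> /x_min /lex_leq; apply; exact: ltn_ord.
pose v := map T (rem (e, (k, a, b, c)) w).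
have w_v : perm_eq (map T w) (root_cell t :: v).
  by rewrite -rootE -map_cons; apply/perm_map/perm_to_rem.
have v_w : {subset v <= map T w}.
  by move=> y y_v; rewrite (perm_mem w_v) inE y_v orbT.
have gen_Tw : all (@proper_cell nat) (map T w).
  rewrite all_map; apply: sub_all gen_w => y gen_y.
  by change (proper_cell (T y)); rewrite (proper_cell_map _ _ s_inj).
have red_Tw : reduced (map T w).
  apply: reduced_relabel red_w => y z /hasP[[e1 y1] y_w /= /eqP yE].
  move=> /hasP[[e2 z1] z_w /= /eqP zE]; subst y1 z1.
  have sub_inj : {in [pred m | k <= m]%N &, injective (subn^~ k)}.
    by move=> m m' km km' mE; rewrite -(subnK km) mE subnK.
  have k_le e' m : (e', m) \in w -> m.1.1.1 \in [pred m | k <= m]%N.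
    by case: m => [[[km am] bm] cm] /k_min.
  exact: (map_cell_inj sub_inj s_inj (k_le _ _ y_w) (k_le _ _ z_w)).
have /run_root/andP[/reduced_testP red_root run_t] :
    t \in [:: 0; 2; 3; 4; 5; 6]%N.
  have t_neq1 : t != 1%N := slope_neq1 ab bc.
  move: t_neq1.
  by rewrite /t; case: (slope a b c) => [[|[|[|[|[|[|[|m]]]]]]]].
have bal_v : balanced (faces level_up (root_cell t) ++ all_faces level_up v).
  rewrite -all_faces_cons.
  apply: balanced_perm (all_faces_perm level_up w_v) _.
  rewrite (all_faces_map (act := level_up)).
  - exact: balanced_relabel.
  - exact: s_inj.
  - by move=> ? ?; exact: affine_op.
  - move=> [e' [[[k' a'] b'] c']] /k_min le d _.
    by rewrite /level_up; exact: subSn.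
have [||||v1 [v2 [v12 null1 bal1]]] := runP run_t red_root _ bal_v.
- by apply: reduced_sub red_Tw => y; rewrite (perm_mem w_v).
- by rewrite size_map size_rem //; case: (size w) size_w.
- by apply/allP => y /v_w; apply/allP.
- apply/allP => y /mapP[[e' [[[k' a'] b'] c']] /mem_rem y_w ->].
  rewrite /allowed /= slope_codeE slope_affine //.
  have := k_min _ _ _ _ _ y_w; have := x_min _ y_w => /=.
  case: (k' - k)%N (subnKC (k_min _ _ _ _ _ y_w)) => //.
  by rewrite addn0 => <-; rewrite leq_add2l.
clear run_t; have v2_v : {subset v2 <= v}.
  by move=> y y_v2; rewrite (perm_mem v12) mem_cat y_v2 orbT.
have size_v2 : (size v2 < size w)%N.
  rewrite -(prednK (size_gt0_mem x_w)) ltnS -(size_rem x_w).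
  by have := perm_size v12; rewrite size_map size_cat => ->; exact: leq_addl.
have null2 : null v2.
  apply: IHn.
  - exact: leq_trans size_v2 size_n.
  - by apply/allP => y /v2_v/v_w; apply/allP.
  - by apply: reduced_sub red_Tw => y /v2_v/v_w.
  - move=> phi; have := bal_v phi; have := bal1 phi.
    rewrite !signed_sum_cat (signed_sum_perm _ (all_faces_perm level_up v12)).
    by rewrite all_faces_cat signed_sum_cat addrA => ->; rewrite add0r.
  - exact: leq_trans (ltnW size_v2) size_w.
apply: (@null_affine nat nat e (subn^~ k) p q) p_neq0 _.
apply: null_perm (null_cat null1 null2).
by rewrite perm_sym (perm_trans w_v) //= perm_cons.
Qed.

(** * Chains as signed lists of cells *)

Lemma signed_sum_filter (T : eqType) (V : zmodType) (phi : T -> V) P l :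
  (forall f, ~~ P f -> phi f.2 = 0) ->
  signed_sum phi [seq f <- l | P f] = signed_sum phi l.
Proof.
move=> P0; rewrite /signed_sum big_filter [RHS](bigID P) /=.
rewrite [X in _ + X]big1 ?addr0 //.
by move=> f /P0 ->; rewrite oppr0 if_same.
Qed.

Lemma raddf_signed_sum (T : eqType) (U V : zmodType) (h : {additive U -> V})
    (phi : T -> U) l :
  h (signed_sum phi l) = signed_sum (h \o phi) l.
Proof.
rewrite /signed_sum raddf_sum; apply: eq_bigr => -[[] x] _ //=.
by rewrite raddfN.
Qed.

HB.instance Definition _ (K : choiceType) (M : lmodType int) (h : K -> M) :=
  GRing.isZmodMorphism.Build {freeg K} M (fglift h)
    (@lift_is_additive int K M h).

Lemma boundary_is_additive (X : quandleType) (S : xset X) m :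
  zmod_morphism (@boundary X S m).
Proof.
move=> x y; rewrite /boundary /boundary_f /boundary_g !raddfB.
by rewrite opprD addrACA.
Qed.

HB.instance Definition _ (X : quandleType) (S : xset X) m :=
  GRing.isZmodMorphism.Build _ _ (@boundary X S m)
    (@boundary_is_additive X S m).

Section Realization.
Variable S : xset R7.

Definition xstep (k : S) (a : R7) : S := xact k (assoc_gen a).

Definition cell_chain (x : ucell S) : chain S 3 :=
  let: (k, a, b, c) := x in term (k, [tuple a; b; c]).

Definition face_chain (f : uface S) : chain S 2 :=
  let: (k, a, b) := f in term (k, [tuple a; b]).

Lemma face_chain0 f : ~~ proper_face f -> face_chain f.2 = 0.
Proof.
case: f => e [[k a] b]; rewrite /= negbK R7_eqbE => /eqP ->.
by rewrite /term insubN // /nondegenerate /= eqxx.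
Qed.

Lemma boundary_cell_chain x : proper_cell (false, x) ->
  boundary (cell_chain x) = signed_sum face_chain (faces xstep (false, x)).
Proof.
case: x => [[[k a] b] c] gen_x.
have nondeg : nondegenerate (k, [tuple a; b; c]).
  by move: gen_x; rewrite /nondegenerate /= !R7_eqbE andbT.
rewrite /faces signed_sum_filter; last exact: face_chain0.
rewrite /= /term insubT /boundary /boundary_f /boundary_g !liftU !scale1r /=.
rewrite /signed_sum !big_cons big_nil /= !big_ord_recl !big_ord0 /=.
have faceE (u v : S * 2.-tuple R7) : u.1 = v.1 ->
    (forall i, tnth u.2 i = tnth v.2 i) -> u = v.
  by case: u v => [k1 t1] [k2 t2] /= -> /eq_from_tnth ->.
rewrite (faceE (face_f _ ord0) (k, [tuple b; c])) //; last first.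
  by case=> [[|[|//]] lt]; rewrite tnth_mktuple !(tnth_nth a).
rewrite (faceE (face_f _ (fintype.lift ord0 ord0)) (k, [tuple a; c])) //;
  last first.
  by case=> [[|[|//]] lt]; rewrite tnth_mktuple !(tnth_nth a).
rewrite (faceE (face_f _ _) (k, [tuple a; b])) //; last first.
  by case=> [[|[|//]] lt]; rewrite tnth_mktuple !(tnth_nth a).
rewrite (faceE (face_g _ ord0) (xstep k a, [tuple b; c])) //; last first.
  by case=> [[|[|//]] lt]; rewrite tnth_mktuple !(tnth_nth a).
rewrite (faceE (face_g _ (fintype.lift ord0 ord0))
  (xstep k b, [tuple R7_mul a b; c])) //; last first.
  by case=> [[|[|//]] lt]; rewrite tnth_mktuple !(tnth_nth a) /= ?R7_mulE.
rewrite (faceE (face_g _ _) (xstep k c, [tuple R7_mul a c; R7_mul b c])) //;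
  last first.
  by case=> [[|[|//]] lt]; rewrite tnth_mktuple !(tnth_nth a) /= ?R7_mulE.
rewrite -!(signr_odd _ (_.+1)) /= !expr0 !expr1 !scale1r !scaleN1r.
by rewrite !addr0 !addrA.
Qed.

Lemma boundary_signed w : all (@proper_cell S) w ->
  boundary (signed_sum cell_chain w) =
  signed_sum face_chain (all_faces xstep w).
Proof.
move=> gen_w; rewrite raddf_signed_sum.
elim: w gen_w => [_|[e x] w IHw /= /andP[gen_x /IHw {}IHw]].
  by rewrite /signed_sum !big_nil.
rewrite all_faces_cons signed_sum_cat -IHw signed_sum_cons; congr (_ + _).
have -> : faces xstep (e, x) =
    map (relabel e (map_face id id)) (faces xstep (false, x)).
  rewrite -(@faces_map S S xstep xstep e id id) //; last first.
    by case: (x) => [[[k a] b] c].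
  by rewrite /relabel addbF; case: (x) => [[[k a] b] c].
rewrite signed_sum_relabel /= boundary_cell_chain //.
have -> : signed_sum (face_chain \o map_face id id) (faces xstep (false, x)) =
   signed_sum face_chain (faces xstep (false, x)).
  by apply: eq_bigr => -[e' [[k a] b]].
by case: (e).
Qed.

Definition ucell_of (u : chain_basis S 3) : ucell S :=
  let t := (val u).2 in ((val u).1, tnth t 0, tnth t 1, tnth t (inord 2)).

(** Each basis element is repeated according to its coefficient, which turns the
    length of a chain into the size of a list. *)
Definition expand (c : chain S 3) : seq (bool * ucell S) :=
  flatten [seq nseq `|coeff u c|%N (coeff u c < 0, ucell_of u) | u <- dom c].

Lemma size_expand c : size (expand c) = chain_length c.
Proof.
rewrite size_flatten /shape -map_comp sumnE big_map /chain_length.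
by apply: eq_bigr => u _; rewrite /= size_nseq.
Qed.

Lemma cell_chain_of (u : chain_basis S 3) : cell_chain (ucell_of u) = << u >>.
Proof.
rewrite /cell_chain /ucell_of.
have -> : ((val u).1, [tuple tnth (val u).2 0; tnth (val u).2 1;
    tnth (val u).2 (inord 2)]) = val u.
  case: u => [[k t] nd] /=; congr (_, _); apply: eq_from_tnth.
  case=> [[|[|[|//]]] lt]; rewrite [LHS](tnth_nth (tnth t 0)) /=;
    congr tnth; apply: val_inj => //=.
  by rewrite inordK.
by rewrite /term valK.
Qed.

Lemma proper_expand c : all (@proper_cell S) (expand c).
Proof.
apply/allP => x /flatten_mapP[u _]; case/nseqP => -> _.
case: u => [[k [[|a1 [|a2 [|a3 []]]] //= sz]] nd].
move: (nd); rewrite /nondegenerate /ucell_of /= !(tnth_nth a1) /= inordK //=.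
by rewrite !R7_eqbE andbT.
Qed.

Lemma signed_sum_expand c : signed_sum cell_chain (expand c) = c.
Proof.
rewrite -[RHS]freeg_sumE /signed_sum /expand big_flatten big_map.
apply: eq_bigr => u _; rewrite big_nseq iter_addr_0 cell_chain_of.
case: (coeff u c) => n /=; first by rewrite freeg_muln natz.
by rewrite mulNrn freeg_muln natz freegUN NegzE.
Qed.

Lemma reduced_expand c : reduced (expand c).
Proof.
move=> f /flatten_mapP[u u_c /nseqP[-> _]]; apply/negP.
case/flatten_mapP=> v v_c /nseqP[[sgn_uv k_uv a_uv b_uv c_uv] _].
have : cell_chain (ucell_of u) = cell_chain (ucell_of v).
  by rewrite /cell_chain /ucell_of k_uv a_uv b_uv c_uv.
rewrite !cell_chain_of => /(congr1 (@dom _ _)); rewrite !domU1 => -[uv].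
by move: sgn_uv; rewrite uv; case: (_ < _).
Qed.

Lemma sum_coeff_dom m (c : chain S m) r : uniq r -> {subset dom c <= r} ->
  (\sum_(u <- r) `|coeff u c|)%N = chain_length c.
Proof.
move=> uniq_r dom_r; rewrite (bigID (mem (dom c))) /=.
rewrite [X in (_ + X)%N]big1 ?addn0.
  rewrite -big_filter /chain_length; apply: perm_big.
  apply: uniq_perm; rewrite ?filter_uniq ?uniq_dom // => u.
  by rewrite mem_filter; case: (boolP (u \in dom c)) => // /dom_r.
by move=> u u_c; rewrite coeff_outdom.
Qed.

Lemma chain_lengthD m (c d : chain S m) :
  (chain_length (c + d)%R <= chain_length c + chain_length d)%N.
Proof.
have dom_r (r : seq (chain_basis S m)) :
    {subset r <= dom c ++ dom d} -> {subset r <= undup (dom c ++ dom d)}.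
  by move=> r_cd u /r_cd; rewrite mem_undup.
rewrite -!(@sum_coeff_dom m _ (undup (dom c ++ dom d))) ?undup_uniq //.
- rewrite -big_split; apply: leq_sum => u _; rewrite coeffD.
  by rewrite -lez_nat PoszD !abszE ler_normD.
- by apply: dom_r => u; rewrite mem_cat => ->; rewrite orbT.
- by apply: dom_r => u; rewrite mem_cat => ->.
- by apply: dom_r; exact: domD_subset.
Qed.

Lemma chain_lengthN m (c : chain S m) : chain_length (- c) = chain_length c.
Proof.
rewrite /chain_length (perm_big _ (domN_perm_eq c)); apply: eq_bigr => u _.
by rewrite coeffN abszN.
Qed.

Lemma chain_length_term m (u : S * m.-tuple R7) :
  (chain_length (term u) <= 1)%N.
Proof.
rewrite /term; case: insubP => [v _ _|_]; rewrite /chain_length.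
  by rewrite domU1 big_seq1 coeffU eqxx.
by rewrite dom0 big_nil.
Qed.

Lemma chain_length_signed_sum w :
  (chain_length (signed_sum cell_chain w) <= size w)%N.
Proof.
elim: w => [|[e [[[k a] b] c]] w IHw].
  by rewrite /signed_sum big_nil /chain_length dom0 big_nil.
rewrite signed_sum_cons; apply: leq_trans (chain_lengthD _ _) _.
rewrite -[size _]/(1 + size w)%N; apply: leq_add IHw => /=.
by case: e; rewrite ?chain_lengthN chain_length_term.
Qed.

End Realization.

Lemma chain_proj_cell (S : xset R7) (x : ucell S) : proper_cell (false, x) ->
  chain_proj (cell_chain x) =
  cell_chain (map_cell (fun=> tt : xset_point R7) id x).
Proof.
case: x => [[[k a] b] c].
rewrite /cell_chain /term /chain_proj /= !R7_eqbE => abc.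
have nondeg : nondegenerate (k, [tuple a; b; c]).
  by rewrite /nondegenerate /= andbT.
by rewrite insubT liftU scale1r.
Qed.

Lemma mochizuki_signed (S : xset R7) (w : seq (bool * ucell S)) :
  all (@proper_cell S) w ->
  mochizuki_map (chain_proj (signed_sum (@cell_chain S) w)) =
  signed_sum (weight 1 0) w.
Proof.
move=> gen_w; rewrite /chain_proj !raddf_signed_sum /signed_sum.
rewrite !big_seq; apply: eq_bigr => -[e x] /(allP gen_w) /= gen_x.
rewrite -/(chain_proj _) chain_proj_cell; last by case: (x) gen_x => [[[]]].
case: x {gen_x} => [[[k a] b] c]; rewrite /cell_chain /= mochizuki_map_term /=.
by rewrite !(tnth_nth a) /= !inordK // !mul1r !addr0.
Qed.

(** A function on proper faces extends to the chain group of degree 2. *)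
Lemma balanced_cycle (S : xset R7) (w : seq (bool * ucell S)) :
  all (@proper_cell S) w -> boundary (signed_sum (@cell_chain S) w) = 0 ->
  balanced (all_faces (@xstep S) w).
Proof.
move=> gen_w; rewrite boundary_signed // => bd0 phi.
pose Phi := fglift (M := int^o) (fun v : chain_basis S 2 =>
  phi ((val v).1, tnth (val v).2 0, tnth (val v).2 1)).
have := congr1 Phi bd0; rewrite /Phi raddf0 raddf_signed_sum => <-.
rewrite /signed_sum !big_seq.
apply: eq_bigr => -[e [[k a] b]] /flatten_mapP[x _].
rewrite mem_filter /= R7_eqbE => /andP[ab _].
have nondeg : nondegenerate (k, [tuple a; b]) by rewrite /nondegenerate /= ab.
by rewrite /= /term insubT liftU scale1r.
Qed.

(** * Layers *)

Definition letter_degree (l : R7 * bool) : int := if l.2 then -1 else 1.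

Definition word_degree (w : word R7) : int := \sum_(l <- w) letter_degree l.

(** All the relators have as many inverses as generators, so the exponent sum of
    a word only depends on its class. *)
Definition degree (g : assoc_group R7) : int := word_degree (repr g).

Lemma word_degree_eq u v :
  pres_eq (@assoc_relator R7) u v -> word_degree u = word_degree v.
Proof.
rewrite /word_degree; elim=> {u v} //.
- by move=> u v w _ -> _ ->.
- by move=> u u' v v' _ eq_u _ eq_v; rewrite !big_cat /= eq_u eq_v.
- by case=> a [] //=; rewrite !big_cons big_nil.
- by move=> w [a [b ->]]; rewrite !big_cons big_nil.
Qed.

Lemma degree_class w :
  degree (pres_class (@assoc_relator R7) w) = word_degree w.
Proof. exact/word_degree_eq/pres_repr. Qed.

Lemma degree1 : degree 1%g = 0.
Proof. by rewrite [degree _]degree_class /word_degree big_nil. Qed.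

Lemma degreeM (g h : assoc_group R7) : degree (g * h)%g = degree g + degree h.
Proof. by rewrite [degree _]degree_class /word_degree big_cat. Qed.

Lemma degree_gen (a : R7) : degree (assoc_gen a) = 1.
Proof. by rewrite [degree _]degree_class /word_degree big_seq1. Qed.

Lemma layer_act1 (k : int) : k + degree 1%g = k.
Proof. by rewrite degree1 addr0. Qed.

Lemma layer_actM (k : int) (g h : assoc_group R7) :
  k + degree (g * h)%g = k + degree g + degree h.
Proof. by rewrite degreeM addrA. Qed.

(** The integers, each generator of the associated group acting by adding 1. *)
Definition layers : xset R7 :=
  @XSet R7 int (fun k g => k + degree g) layer_act1 layer_actM.

Lemma layers_bounded (w : seq (bool * ucell layers)) :
  exists m : nat, forall x, x \in w -> 0 <= (x.2.1.1.1 : int) + m%:Z.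
Proof.
elim: w => [|[e [[[k a] b] c]] w [m IHw]]; first by exists 0%N.
exists (m + `|(k : int)|)%N => x; rewrite inE => /predU1P[-> /=|/IHw]; lia.
Qed.

(** Only finitely many layers are occupied, so they can be numbered by natural
    numbers. *)
Lemma short_layered_cycle (c : chain layers 3) : boundary c = 0 ->
  (chain_length c <= 7)%N -> mochizuki_map (chain_proj c) = 0.
Proof.
have gen_c := proper_expand c; have red_c := reduced_expand (c := c).
rewrite -{1 3}(signed_sum_expand c) -size_expand => bd0 size_c.
rewrite mochizuki_signed //; have bal_c := balanced_cycle gen_c bd0.
have [m m_c] := layers_bounded (expand c).
pose h (k : layers) := absz ((k : int) + m%:Z).
pose T := relabel false (map_cell h id).
have id_inj : injective (id : R7 -> R7) by [].
have null_c : null (map T (expand c) : seq cell); last first.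
  have := null_c 1 0; rewrite signed_sum_relabel /= => null0.
  by rewrite -[RHS]null0; apply: eq_bigr => -[e [[[k a] b] c']].
apply: short_cycle_null.
- rewrite all_map; apply: sub_all gen_c => y gen_y.
  by change (proper_cell (T y)); rewrite (proper_cell_map _ _ id_inj).
- apply: reduced_relabel red_c => y z /hasP[[e1 y1] y_c /= /eqP yE].
  move=> /hasP[[e2 z1] z_c /= /eqP zE]; subst y1 z1.
  have h_inj : {in [pred k : layers | 0 <= (k : int) + m%:Z] &, injective h}.
    move=> k k'; rewrite !inE /h => k_ge0 k'_ge0 kE.
    by apply: (@addIr _ m%:Z); rewrite -(gez0_abs k_ge0) -(gez0_abs k'_ge0) kE.
  exact: (map_cell_inj h_inj id_inj (m_c _ y_c) (m_c _ z_c)).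
- rewrite (all_faces_map (act := @xstep layers)) //.
    exact: balanced_relabel.
  move=> [e [[[k a] b] d]] /m_c /= k_ge0 d' _.
  rewrite /h /xstep /= degree_gen /level_up; lia.
- by rewrite size_map.
Qed.

(** * A detecting cycle of length eight *)

Section AssociatedGroup.
Local Open Scope group_scope.
Local Notation g := (@assoc_gen R7).

Lemma assoc_gen_op (a b : R7) : g a * g b = g b * g (qop a b).
Proof.
have inv_g (x : R7) : (g x)^-1 = pres_class (@assoc_relator R7) [:: (x, true)].
  exact: pres_invE.
have gE (x : R7) : g x = pres_class (@assoc_relator R7) [:: (x, false)] by [].
have mulE (x y : assoc_group R7) : x * y = pres_mul x y by [].
have : (g b)^-1 * g a * g b * (g (qop a b))^-1 = 1.
  rewrite !inv_g !gE !mulE !pres_mulE -[1]/(pres_class _ [::]).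
  by apply/pres_classP/pres_relator; exists a, b.
move=> /(canRL (mulgK _)); rewrite invgK mul1g -mulgA => /(canRL (mulKg _)).
by rewrite invgK.
Qed.

(** Conjugation shifts both colours of a product by their difference d; it can
    be repeated. *)
Lemma assoc_gen_shift (a d : R7) (n : nat) :
  g a * g (a + d)%R = g (a + d *+ n)%R * g (a + d *+ n + d)%R.
Proof.
elim: n => [|n IHn]; first by rewrite mulr0n addr0.
rewrite IHn assoc_gen_op mulrSr addrA; congr (_ * g _).
by rewrite /qop /= /R7_op; ring.
Qed.

(** Squares are central, and conjugate generators therefore have the same
    square; a is conjugate to 0 by 4a, because 2 * 4a - a = 0 modulo 7. *)
Lemma assoc_gen_square (a : R7) : g a * g a = g 0%R * g 0%R.
Proof.
pose b : R7 := (4 * a)%R.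
have ab : qop a b = 0%R :> R7.
  by move: @b; apply/eqP; move: a; apply: R7_all; vm_compute.
have comm (x y : R7) : g x * (g y * g y) = g y * g y * g x.
  by rewrite mulgA (assoc_gen_op x) -mulgA (assoc_gen_op (qop x y)) qopK mulgA.
apply: (mulgI (g b)); rewrite comm -mulgA (assoc_gen_op a) ab.
by rewrite mulgA (assoc_gen_op a) ab mulgA.
Qed.

(** A nonzero difference b - a generates the residues modulo 7, so that some
    multiple of it shifts a to 0. *)
Lemma assoc_gen_mul (a b : R7) : g a * g b = g 0%R * g (b - a)%R.
Proof.
have [->|ab] := eqVneq b a; first by rewrite subrr assoc_gen_square.
pose d : R7 := (b - a)%R; have d_neq0 : d != 0%R by rewrite subr_eq0.
have dn : (d *+ (d ^+ 5 * - a)%R)%R = (- a)%R.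
  by rewrite -mulr_natr natr_Zp mulrA (mulrC d) R7_expX6 // mul1r.
rewrite -[b](subrKC a) -/d (assoc_gen_shift _ _ (d ^+ 5 * - a)%R) dn.
by rewrite subrr add0r addrC addKr.
Qed.
End AssociatedGroup.

(** A model of the elements of an X-set needed below: 0 stands for s, 1 + a for
    s^a, and 8 + d for (s^0)^d, which by assoc_gen_mul is also (s^a)^(a + d). *)
Definition octet_step (k : nat) (a : R7) : nat :=
  if k is k'.+1 then
    if (k' < 7)%N then (8 + (a - R7_nat k')%R)%N else 0%N
  else a.+1.

(** In the notation of chains, this is
    (s; 0, 1, 4) + (s; 1, 0, 4) - (s; 4, 0, 1) - (s; 4, 1, 0)
    - (s^0; 1, 6, 4) + (s^0; 3, 1, 6) - (s^1; 0, 2, 4) + (s^1; 5, 0, 2). *)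
Definition octet : seq cell :=
  [seq (x.1, (x.2.1, R7_nat x.2.2.1.1, R7_nat x.2.2.1.2, R7_nat x.2.2.2)) | x <-
  [:: (false, (0%N, (0, 1, 4))); (false, (0%N, (1, 0, 4)));
      (true, (0%N, (4, 0, 1))); (true, (0%N, (4, 1, 0)));
      (true, (1%N, (1, 6, 4))); (false, (1%N, (3, 1, 6)));
      (true, (2%N, (0, 2, 4))); (false, (2%N, (5, 0, 2)))]]%N.

Section Octet.
Variables (S : xset R7) (s : S).

Definition octet_index (k : nat) : S :=
  if k is k'.+1 then
    if (k' < 7)%N then xact s (assoc_gen (R7_nat k'))
    else xact s (assoc_gen (0 : R7) * assoc_gen (R7_nat (k' - 7)))%g
  else s.

Lemma octet_index_far (a : R7) :
  octet_index (8 + a) = xact s (assoc_gen (0 : R7) * assoc_gen a)%g.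
Proof.
transitivity (octet_index (7 + a).+1) => //.
by rewrite /octet_index ltnNge leq_addr addKn R7_natK.
Qed.

Lemma octet_index_step k a : (k < 8)%N ->
  octet_index (octet_step k a) = xstep (octet_index k) a.
Proof.
case: k => [_|k]; first by rewrite /= ltn_ord R7_natK.
rewrite ltnS => k_lt7; rewrite /octet_step k_lt7 octet_index_far.
by rewrite /octet_index k_lt7 /xstep -xactM (assoc_gen_mul (R7_nat k)).
Qed.

Lemma octet_detects :
  exists2 n, detecting_length mochizuki_cocycle S n & (n <= 8)%N.
Proof.
pose T := relabel false (map_cell octet_index id).
pose w : seq (bool * ucell S) := map T octet.
have id_inj : injective (id : R7 -> R7) by [].
have gen_w : all (@proper_cell S) w by vm_compute.
exists (chain_length (signed_sum (@cell_chain S) w)); last first.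
  exact: chain_length_signed_sum.
exists (signed_sum (@cell_chain S) w); split=> //.
  rewrite boundary_signed //.
  rewrite (all_faces_map (act := octet_step)) // => [|x].
    rewrite signed_sum_relabel /=.
    have faces0 : foldl (@insert _) [::] (all_faces octet_step octet) = [::].
      by vm_compute.
    rewrite -[all_faces _ _]cat0s -signed_sum_insert faces0.
    by rewrite /signed_sum big_nil.
  have : all (fun x : cell => x.2.1.1.1 < 8)%N octet by vm_compute.
  move=> /allP lt8 /lt8; case: x => [e [[[k a] b] c]] /= k_lt8 d _.
  exact: octet_index_step.
rewrite [mochizuki_cocycle _]mochizuki_signed // signed_sum_relabel /=.
by rewrite /signed_sum !big_cons big_nil /= !mochizukiE; apply/eqP; vm_compute.
Qed.
End Octet.

Local Close Scope ring_scope.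

Theorem theorem1p1 : cocycle_length mochizuki_cocycle = Some 8.
Proof.
have le8 S : (length_wrt mochizuki_cocycle S <= 8)%N.
  rewrite /length_wrt; case: pselect => // ex; case: ex_minnP => n _ n_min.
  have [m /asboolP[c [_ c_neq0 _]]] := ex.
  have [[s _]|S0] := pselect (exists s : S, True).
    have [k det_k k_le8] := octet_detects s.
    by apply: leq_trans (n_min _ _) k_le8; apply/asboolP.
  (* Without an element s, the chain c is empty. *)
  case: c_neq0; rewrite -(signed_sum_expand c).
  case: (expand c) => [|[e [[[s a] b] d]] w]; last by case: S0; exists s.
  by rewrite /signed_sum big_nil /chain_proj !raddf0.
have layers8 : length_wrt mochizuki_cocycle layers = 8.
  apply/eqP; rewrite eqn_leq le8 /length_wrt /=; case: pselect => [ex|no_ex].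
    case: ex_minnP => n /asboolP[c [bd0 c_neq0 cn]] _; rewrite ltnNge -cn.
    by apply/negP => /(short_layered_cycle bd0).
  case: no_ex; have [n det_n _] := @octet_detects layers (0%R : int).
  by exists n; apply/asboolP.
rewrite /cocycle_length; case: pselect => [bounded|[]]; last by exists 8.
congr Some; case: ex_maxnP => n /asboolP[S Sn] n_max.
apply/eqP; rewrite eqn_leq -{1}Sn le8 n_max //.
by apply/asboolP; exists layers.
Qed.
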